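(* For each $n \in \{105, 117\}$ there exists a connected $4$-regular graph with $n$ vertices and girth $6$ for which there is a design.
   Context: All graphs are finite and simple (undirected, no loops, no multiple edges). A graph is $\delta$-regular if every vertex has exactly $\delta$ neighbours. The girth of a graph is the length of a shortest cycle in it. For a vertex $i$, $N(i)$ is the set of neighbours of $i$ and $N[i] = \{i\} \cup N(i)$ is its closed neighbourhood. Let $\delta \ge 2$ and let $G$ be a $\delta$-regular graph with vertex set $V$, $|V| = n$, and girth at least $5$. A design for $G$ (a design of order $n$) is a collection $\mathcal{B}$ of subsets of $V$, called blocks, such that: (i) each block has exactly $\delta + 1$ elements; (ii) each point of $V$ lies in the same number of blocks; (iii) each pair of distinct points of $V$ that is not an edge of $G$ is contained in exactly one block; (iv) each pair of points of $V$ that is an edge of $G$ is contained in exactly two blocks; and (v) every closed neighbourhood $N[i]$, $i \in V$, is a block. (That is, a regular-graph design with $\lambda = 1$ and block size $\delta+1$ in which all the duplicated pairs come from the neighbourhood blocks $N[i]$.) *)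

(* Defs.v *)
From mathcomp Require Import all_boot.

Set Implicit Arguments.
Unset Strict Implicit.
Unset Printing Implicit Defensive.

(* A graph on the vertex set V is given by its adjacency relation e : rel V. *)

Section Graphs.

Variable V : finType.
Implicit Types (e : rel V) (B : {set {set V}}).

Definition simple_graph e : Prop := symmetric e /\ irreflexive e.

Definition neighbours e (i : V) : {set V} := [set j | e i j].

Definition closed_neighbours e (i : V) : {set V} := i |: neighbours e i.

Definition regular_graph (delta : nat) e : Prop :=
  forall i : V, #|neighbours e i| = delta.

Definition connected_graph e : Prop := forall i j : V, connect e i j.

(* [:: x_1; ...; x_k] stands for the closed walk x_1, ..., x_k, x_1. The size
   bound excludes the empty list, loops, and a single edge traversed back and
   forth, all of which cycle and uniq allow. *)
Definition graph_cycle e (c : seq V) : bool :=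
  [&& 3 <= size c, cycle e c & uniq c].

(* A graph without cycles has no girth in this sense. *)
Definition has_girth e (g : nat) : Prop :=
  (exists2 c : seq V, graph_cycle e c & size c = g) /\
  (forall c : seq V, graph_cycle e c -> g <= size c).

Definition blocks_through B (A : {set V}) : {set {set V}} :=
  [set b in B | A \subset b].

(* Meant for delta-regular graphs with delta >= 2 and girth at least 5. The
   collection of blocks can be a set rather than a multiset: all pairs in a
   repeated block would be edges, by the conditions on pairs, so the graph
   would contain a triangle. *)
Definition is_design (delta : nat) e B : Prop :=
  [/\ forall b : {set V}, b \in B -> #|b| = delta.+1,
      exists r : nat, forall x : V, #|blocks_through B [set x]| = r,
      forall x y : V, x != y -> ~~ e x y -> #|blocks_through B [set x; y]| = 1,
      forall x y : V, e x y -> #|blocks_through B [set x; y]| = 2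
    & forall i : V, closed_neighbours e i \in B].

End Graphs.

(* Main.v *)
Require Import Defs.
From mathcomp Require Import all_boot.

Set Implicit Arguments.
Unset Strict Implicit.
Unset Printing Implicit Defensive.

(** Fix a 4-regular graph of girth at least 5.  Its neighbourhood blocks N[i]
    cover every edge twice (from both ends), every pair at distance 2 once (from
    the unique common neighbour), and no other pair.  A design is therefore the
    same thing as a partition of the pairs at distance at least 3 into 5-cliques
    of the graph of those pairs.  Such a partition is sought among the unions of
    orbits of a large group of automorphisms, so that only a few base blocks,
    one for each orbit, have to be chosen: the pairs inside them must represent
    every orbit of pairs at distance at least 3 exactly once, as in a difference
    family.

    In both cases the points are pairs (x, y), with x an integer modulo m, and
    the group is generated by the translation t : (x, y) -> (x + 1, y) and by a
    multiplier tau : (x, y) -> (c x, pi y).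

    - For 117 points, m = 13 and tau (x, y) = (3 x, y + 1) with y modulo 9.  The
      group is non-abelian of order 117 and acts regularly, so the points can be
      identified with its elements t^x tau^y and the graph is a Cayley graph,
      generated by (1, 0) and (8, 7).  (In an abelian group, two commuting
      generators would close a 4-cycle.)  The 58 * 117 pairs form 58 orbits, of
      which 2 consist of edges and 6 of pairs at distance 2; the 50 others are
      represented by the 50 pairs inside 5 base blocks.

    - For 105 points, no group acting regularly can work: 462 blocks have to be
      found besides the N[i], and an orbit of 5-sets has length 105 or 21, where
      length 21 only occurs for the cosets of the unique subgroup of order 5,
      whereas 462 = 4 * 105 + 42.  So m = 21, tau (x, y) = (16 x, pi y), where
      pi is the 3-cycle (0 1 2) on {0, 1, 2, 3, 4}, and the group has order 63,
      with a regular orbit (y < 3) and two orbits of length 21 (y = 3, y = 4).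
      The pairs at distance at least 3 form 72 orbits of length 63 and 4 orbits
      of length 21, the latter being those of pairs of points fixed by the same
      elements of order 3.  Four base blocks invariant under tau, each with one
      pair from a short orbit and nine pairs that represent three long orbits,
      and six other base blocks with ten pairs each represent all of them.

    The base blocks come from a backtracking search.  That they work is a finite
    computation on lists of points, and the lemmas below (collected in
    [certificate_sound]) turn its outcome into the required statement about a
    finite type. *)

(** * Graphs and designs given by lists *)

Section Certificate.

Variables (T : choiceType) (points : seq T) (nbr : T -> seq T).
Variable blocks : seq (seq T).

Local Notation V := (seq_sub points).

Definition adjacent : rel V := fun u v => val v \in nbr (val u).

Definition trace (s : seq T) : {set V} := [set v | val v \in s].

Lemma card_trace s : uniq s -> {subset s <= points} -> #|trace s| = size s.
Proof.
move=> s_uniq s_sub; rewrite cardE -(size_map val).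
apply/perm_size/uniq_perm => //.
  by rewrite (map_inj_uniq val_inj) enum_uniq.
move=> x; apply/mapP/idP => [[v]|xs]; first by rewrite mem_enum inE => ? ->.
by exists (SeqSub (s_sub _ xs)); rewrite // mem_enum inE.
Qed.

Lemma lift_seq s : {subset s <= points} -> exists c : seq V, map val c = s.
Proof.
elim: s => [|x s IHs] s_sub; first by exists [::].
have [y ys|c cE] := IHs; first by apply: s_sub; rewrite inE ys orbT.
by exists (SeqSub (s_sub x (mem_head x s)) :: c); rewrite /= cE.
Qed.

Definition graph_check (delta : nat) : bool :=
  all (fun x => [&& uniq (nbr x), size (nbr x) == delta, x \notin nbr x,
                    all [in points] (nbr x)
                  & all (fun y => x \in nbr y) (nbr x)]) points.

Lemma adjacent_simple delta : graph_check delta -> simple_graph adjacent.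
Proof.
move=> /allP graph_ok; split=> [u v|u]; last first.
  by apply/negbTE; case/and5P: (graph_ok _ (valP u)).
suff sym w z : adjacent w z -> adjacent z w by apply/idP/idP; apply: sym.
by case/and5P: (graph_ok _ (valP w)) => _ _ _ _ /allP; apply.
Qed.

Lemma adjacent_regular delta :
  graph_check delta -> regular_graph delta adjacent.
Proof.
move=> /allP graph_ok v.
case/and5P: (graph_ok _ (valP v)) => nbr_uniq /eqP <- _ /allP nbr_sub _.
exact: card_trace nbr_uniq nbr_sub.
Qed.

(** * Connectedness *)

Definition visit (s : seq T) (x : T) : seq T :=
  if (x \notin s) && has [in s] (nbr x) then x :: s else s.

(** Several passes over the points are made because a point may come before all
    the points that link it to the root. *)
Definition reached (passes : nat) (root : T) : seq T :=
  iter passes (fun s => foldl visit s points) [:: root].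

Definition connected_check (passes : nat) (root : T) : bool :=
  let s := reached passes root in all [in s] points.

Lemma adjacent_connected passes (root : T) :
    symmetric adjacent -> root \in points ->
  connected_check passes root -> connected_graph adjacent.
Proof.
move=> sym root_in /allP all_reached.
pose r : V := SeqSub root_in.
pose inv (s : seq T) := {subset s <= points} /\
  forall v : V, val v \in s -> connect adjacent v r.
have inv_visit s x : x \in points -> inv s -> inv (visit s x).
  move=> x_in [s_sub s_conn]; rewrite /visit.
  case: ifP => // /andP[_ /hasP[y xy ys]]; split=> [z|v]; rewrite inE.
    by case/predU1P=> [->|/s_sub].
  case/predU1P=> [v_x|/s_conn //].
  apply: connect_trans (s_conn (SeqSub (s_sub _ ys)) ys).
  by apply: connect1; rewrite /adjacent v_x.
have inv_pass s : inv s -> inv (foldl visit s points).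
  have: {subset points <= points} by [].
  move: {1 3}points => l; elim: l s => //= x l IHl s l_sub s_inv.
  apply: IHl => [y yl|]; first by apply: l_sub; rewrite inE yl orbT.
  by apply: inv_visit => //; apply/l_sub/mem_head.
have [_ conn_r] : inv (reached passes root).
  rewrite /reached; elim: passes {all_reached} => [|k IHk] /=.
    split=> [x|v]; rewrite inE => /eqP; first by move->.
    by move=> v_root; have -> : v = r by apply: val_inj.
  exact: inv_pass.
move=> u v; apply: (connect_trans (conn_r _ (all_reached _ (valP u)))).
rewrite (sym_connect_sym sym); exact: conn_r (all_reached _ (valP v)).
Qed.

(** * Girth *)

(** [no_return s k p q] says that a walk that has just gone from [p] to [q] and
    goes on for at most [k] steps, without ever turning back, does not step on
    the set [s]. *)
Fixpoint no_return (s : seq T) (k : nat) (p q : T) : bool :=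
  if k is j.+1 then
    all (fun z => (z == p) || (z \notin s) && no_return s j q z) (nbr q)
  else true.

Definition girth_check (k : nat) : bool :=
  all (fun x => let nx := nbr x in all (no_return nx k x) nx) points.

Lemma no_return_path (x : V) k (p q : V) s :
    no_return (nbr (val x)) k (val p) (val q) -> path adjacent q s ->
  uniq [:: p, q & s] -> 0 < size s <= k -> ~~ adjacent x (last q s).
Proof.
elim: k p q s => [|k IHk] p q [|z s] //= /allP ret /andP[qz zs].
rewrite !inE !negb_or => /andP[/and3P[pq pz ps] qzs_uniq] s_size.
have := ret _ qz; rewrite (inj_eq val_inj) eq_sym (negPf pz) /=.
case/andP=> xz retz.
case: s => [|w s] in zs ps qzs_uniq s_size *; first by [].
by apply: (IHk q z) => //; rewrite /= inE negb_or.
Qed.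

(** A cycle of length at most [k.+2], read from one of its points [x], is a step
    from [x] to a neighbour followed by a walk of between 1 and [k] steps that
    ends next to [x]. *)
Lemma girth_at_least k : symmetric adjacent -> girth_check k ->
  forall c : seq V, graph_cycle adjacent c -> k.+3 <= size c.
Proof.
move=> sym /allP ok [|x [|y s]] // /and3P[s_gt0].
rewrite /= rcons_path => /and3P[xy ys lx] c_uniq.
rewrite ltnNge; apply/negP=> s_le; have s_range : 0 < size s <= k by apply/andP.
have /negP[] := no_return_path (allP (ok _ (valP x)) _ xy) ys c_uniq s_range.
by rewrite sym.
Qed.

Definition cycle_check (c : seq T) : bool :=
  [&& all [in points] c, cycle (fun x y => y \in nbr x) c & uniq c].

Lemma lift_cycle c : 2 < size c -> cycle_check c ->
  exists2 c' : seq V, graph_cycle adjacent c' & size c' = size c.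
Proof.
move=> c_gt2 /and3P[/allP/lift_seq[c' c'E]].
rewrite -{}c'E size_map in c_gt2 *; rewrite cycle_map => c'_cycle /map_uniq.
by exists c' => //; apply/and3P.
Qed.

(** * Designs *)

Definition non_edge_in (b : seq T) : bool :=
  has (fun x => has (fun y => (x != y) && (y \notin nbr x)) b) b.

(** The condition that every block contains a non-edge makes the blocks of the
    list distinct as sets: a non-edge lies in a single term of the list. *)
Definition design_check (delta r : nat) : bool :=
  [&& all (fun b => [&& uniq b, size b == delta.+1, all [in points] b
                      & non_edge_in b]) blocks,
      all (fun x => x :: nbr x \in blocks) points
    & all (fun x => let through := [seq b <- blocks | x \in b] in
        let nx := nbr x in
        (size through == r) &&
        all (fun y => (y == x) ||
          (count (fun b => y \in b) through == (y \in nx).+1)) points) points].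

Definition design_blocks : {set {set V}} := [set:: map trace blocks].

Lemma design_check_sound delta r :
    irreflexive adjacent -> design_check delta r ->
  is_design delta adjacent design_blocks.
Proof.
move=> irr /and3P[/allP shape /allP closed /allP cover].
have count_pair (x y : V) : x != y ->
    count (fun b => [set x; y] \subset trace b) blocks = (adjacent x y).+1.
  move=> xy; have /andP[_ /allP/(_ _ (valP y))] := cover _ (valP x).
  rewrite (inj_eq val_inj) eq_sym (negPf xy) /= => /eqP <-.
  rewrite count_filter; apply: eq_count => b /=.
  by rewrite subUset !sub1set !inE andbC.
have trace_uniq : uniq (map trace blocks).
  apply: count_mem_uniq => B; case: (boolP (B \in _)); last by move/count_memPn.
  case/mapP=> b b_in ->; apply/eqP; rewrite eqn_leq.
  apply/andP; split; last first.
    by rewrite -has_count has_pred1 map_f.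
  have /and4P[_ _ /allP b_sub] := shape _ b_in.
  case/hasP=> x xb /hasP[y yb /andP[xy nxy]].
  pose u : V := SeqSub (b_sub _ xb); pose v : V := SeqSub (b_sub _ yb).
  have uv : u != v by [].
  have one_block : count (fun b' => [set u; v] \subset trace b') blocks = 1.
    by rewrite count_pair // /adjacent /= (negPf nxy).
  rewrite -[X in _ <= X]one_block count_map; apply: sub_count => b' /= /eqP ->.
  by rewrite subUset !sub1set !inE /= xb yb.
have card_through A :
    #|blocks_through design_blocks A| =
    count (fun b => A \subset trace b) blocks.
  rewrite /blocks_through -(count_map trace (fun B => A \subset B)).
  rewrite -size_filter.
  rewrite -(card_uniqP (filter_uniq _ trace_uniq)); apply: eq_card => B.
  by rewrite !inE mem_filter andbC.
split=> [B||x y xy nxy|x y xy|x].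
- rewrite inE => /mapP[b /shape/and4P[b_uniq /eqP <- /allP b_sub _] ->].
  exact: card_trace.
- exists r => x; have /andP[/eqP <- _] := cover _ (valP x).
  rewrite card_through size_filter; apply: eq_count => b /=.
  by rewrite sub1set inE.
- by rewrite card_through count_pair // (negPf nxy).
- rewrite card_through count_pair ?xy //.
  by apply: contraTneq xy => ->; rewrite irr.
- rewrite inE; apply/mapP; exists (val x :: nbr (val x)).
    exact: closed (valP x).
  by apply/setP=> y; rewrite !inE (inj_eq val_inj).
Qed.

End Certificate.

Definition certificate (T : choiceType) (points : seq T) (nbr : T -> seq T)
    (blocks : seq (seq T)) (delta k r passes : nat) (root : T) (c : seq T) :=
  [&& uniq points, graph_check points nbr delta,
      connected_check points nbr passes root, girth_check points nbr k,
      (size c == k.+2) && cycle_check points nbr (root :: c)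
    & design_check points nbr blocks delta r].

Lemma certificate_sound (T : choiceType) (points : seq T) (nbr : T -> seq T)
    (blocks : seq (seq T)) (delta k r passes : nat) (root : T) (c : seq T) :
    certificate points nbr blocks delta k r passes root c ->
  exists (V : finType) (e : rel V),
    #|V| = size points /\ simple_graph e /\ connected_graph e /\
    regular_graph delta e /\ has_girth e k.+3 /\
    (exists B : {set {set V}}, is_design delta e B).
Proof.
case/and5P=> points_uniq graph_ok conn_ok girth_ok.
case/andP=> /andP[/eqP c_size c_ok] design_ok.
have [sym irr] := adjacent_simple graph_ok.
have root_in : root \in points by case/and3P: c_ok => /andP[].
exists (seq_sub points), (adjacent (points := points) nbr).
split; first exact: card_seq_sub.
split=> //; split; first exact: adjacent_connected sym root_in conn_ok.
split; first exact: adjacent_regular.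
split; last first.
  by exists (design_blocks points blocks); apply: design_check_sound design_ok.
split; last exact: girth_at_least.
have [|c' c'_cycle c'_size] := lift_cycle _ c_ok; first by rewrite /= c_size.
by exists c'; rewrite ?c'_size /= ?c_size.
Qed.

(** * The two designs *)

Definition translate (m a : nat) (p : nat * nat) := ((p.1 + a) %% m, p.2).

(** The images of a base block under t^a tau^b for [a < m] and [b < h].  With
    [h = 1] these are all the images of a base block invariant under tau. *)
Definition develop (m : nat) (tau : nat * nat -> nat * nat) (h : nat)
    (base : seq (nat * nat)) : seq (seq (nat * nat)) :=
  [seq map (translate m a) (map (iter b tau) base)
     | a <- iota 0 m, b <- iota 0 h].

Definition grid (m k : nat) : seq (nat * nat) :=
  [seq (x, y) | x <- iota 0 m, y <- iota 0 k].

Definition neighbour_blocks (points : seq (nat * nat))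
    (nbr : nat * nat -> seq (nat * nat)) : seq (seq (nat * nat)) :=
  [seq p :: nbr p | p <- points].

Definition tau117 (p : nat * nat) := ((3 * p.1) %% 13, p.2.+1 %% 9).

(** The products of (x, y) = t^x tau^y on the right by (1, 0), (8, 7) and their
    inverses (12, 0) and (6, 2); [c] is 3^y modulo 13, and 3 has order 3. *)
Definition nbr117 (p : nat * nat) :=
  let: (x, y) := p in let c := nth 0 [:: 1; 3; 9] (y %% 3) in
  [:: ((x + c) %% 13, y); ((x + 12 * c) %% 13, y);
      ((x + 8 * c) %% 13, (y + 7) %% 9); ((x + 6 * c) %% 13, (y + 2) %% 9)].

Definition blocks117 :=
  neighbour_blocks (grid 13 9) nbr117 ++
  flatten (map (develop 13 tau117 9)
    [:: [:: (0, 0); (0, 3); (6, 1); (10, 4); (12, 7)];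
        [:: (0, 0); (2, 5); (2, 3); (12, 3); (12, 8)];
        [:: (0, 0); (9, 8); (3, 7); (5, 6); (7, 5)];
        [:: (0, 0); (2, 4); (1, 1); (4, 4); (7, 8)];
        [:: (0, 0); (6, 0); (3, 8); (5, 5); (6, 8)]]).

Definition tau105 (p : nat * nat) :=
  ((16 * p.1) %% 21, if p.2 < 3 then p.2.+1 %% 3 else p.2).

(** The edges are the images of (0, 0)(5, 0), (0, 0)(0, 3), (2, 0)(0, 4) and
    (0, 3)(0, 4); [c] is 16^y modulo 21. *)
Definition nbr105 (p : nat * nat) :=
  let: (x, y) := p in
  if y < 3 then
    let c := nth 0 [:: 1; 16; 4] y in
    [:: ((x + 5 * c) %% 21, y); ((x + 16 * c) %% 21, y);
        (x, 3); ((x + 19 * c) %% 21, 4)]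
  else if y == 3 then [:: (x, 0); (x, 1); (x, 2); (x, 4)]
  else [:: ((x + 2) %% 21, 0); ((x + 11) %% 21, 1); ((x + 8) %% 21, 2); (x, 3)].

Definition blocks105 :=
  neighbour_blocks (grid 21 5) nbr105 ++
  flatten (map (develop 21 tau105 1)
    [:: [:: (0, 3); (14, 4); (10, 0); (13, 1); (19, 2)];
        [:: (0, 3); (7, 4); (20, 0); (5, 1); (17, 2)];
        [:: (0, 4); (7, 4); (12, 0); (3, 1); (6, 2)];
        [:: (0, 3); (7, 3); (8, 4); (2, 4); (11, 4)]]) ++
  flatten (map (develop 21 tau105 3)
    [:: [:: (0, 0); (1, 0); (3, 0); (7, 0); (20, 1)];
        [:: (0, 0); (10, 3); (2, 2); (6, 4); (7, 4)];
        [:: (0, 0); (16, 1); (9, 0); (10, 2); (13, 3)];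
        [:: (0, 3); (1, 3); (7, 1); (15, 2); (12, 3)];
        [:: (0, 0); (17, 3); (15, 1); (5, 2); (2, 4)];
        [:: (0, 0); (1, 1); (8, 0); (18, 4); (20, 4)]]).

(** Through a point pass 5 blocks N[i] and 25 others, which partition the
    117 - 17 = 100 points at distance at least 3 into sets of 4. *)
Lemma certificate117 :
  certificate (grid 13 9) nbr117 blocks117 4 3 30 3 (0, 0)
    [:: (1, 0); (2, 0); (3, 0); (11, 7); (8, 7)].
Proof. by vm_compute. Qed.

(** Here 105 - 17 = 88 points are at distance at least 3 from a given one, so 22
    blocks pass through it besides the 5 blocks N[i]. *)
Lemma certificate105 :
  certificate (grid 21 5) nbr105 blocks105 4 3 27 2 (0, 0)
    [:: (5, 0); (5, 3); (5, 1); (9, 1); (19, 4)].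
Proof. by vm_compute. Qed.

Theorem mainTheorem3 :
  forall n : nat, n = 105 \/ n = 117 ->
  exists (V : finType) (e : rel V),
    #|V| = n /\ simple_graph e /\ connected_graph e /\ regular_graph 4 e /\
    has_girth e 6 /\ (exists B : {set {set V}}, is_design 4 e B).
Proof.
move=> n [->|->]; first exact: certificate_sound certificate105.
exact: certificate_sound certificate117.
Qed.
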